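(* Let $(M,g)$ be a space-time with Levi-Civita connection $\nabla$, Ricci tensor $Ric$ and scalar curvature $s$, and let $T=Ric-\tfrac12 s\,g$ be the energy-momentum tensor given by the Einstein equations. Then the Einstein equations belong to the class $\Omega_2$, i.e. $\nabla_kT_{ij}=\nabla_iT_{kj}$, if and only if $\nabla$, considered as a connection in the bundle $TM$ (with fiber metric $g$), is a Yang-Mills field.
   Context: A space-time $(M,g)$ is a smooth four-dimensional manifold $M$ with a metric $g$ of Lorentz signature $(-+++)$; $\nabla$ is its Levi-Civita connection. The curvature tensor is given by $R^k_{lij}X^l=\nabla_i\nabla_jX^k-\nabla_j\nabla_iX^k$, the Ricci tensor by $R_{ij}=R^k_{ikj}$, and the scalar curvature by $s=g^{ij}R_{ij}$. The Einstein equations are $R_{ij}-\tfrac12 s\,g_{ij}=T_{ij}$. The Einstein equations belong to the class $\Omega_2$ if $\nabla_kT_{ij}=\nabla_iT_{kj}$ everywhere on $M$. A connection $\hat\nabla$ in a bundle $E\to M$ over a pseudo-Riemannian manifold $(M,g)$ with fiber metric $g_E$ is called a Yang-Mills field if its curvature $\hat R$ (an $\mathrm{End}(E)$-valued 2-form, which satisfies the Bianchi identity $d\hat R=0$) satisfies the Yang-Mills equations $d^*\hat R=0$, where $d^*$ is the codifferential on bundle-valued forms. For $E=TM$, $g_E=g$, $\hat\nabla=\nabla$ the Levi-Civita connection, the equation $d^*R=0$ reads $g^{mi}\nabla_mR^k_{lij}=0$, equivalently (by the pair symmetry of $R$) $\nabla_kR^k_{lij}=0$. *)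

(* Defs.v *)
From HB Require Import structures.
From mathcomp Require Import all_boot all_order all_algebra.
From mathcomp Require Import all_classical all_reals all_analysis.

Set Implicit Arguments.
Unset Strict Implicit.
Unset Printing Implicit Defensive.

Import Order.TTheory GRing.Theory Num.Theory.
Import numFieldNormedType.Exports.

Local Open Scope classical_set_scope.
Local Open Scope ring_scope.

(* Manifolds, bundles and tensors are described by their components in charts
   and local frames.  Components are functions on the manifold, only meaningful
   on the domain of the chart they refer to; they are differentiated through
   the inverse of that chart. *)

(* Smoothness of order k is meant for open sets U. *)
Fixpoint Ck (R : realType) (n : nat) (W : normedModType R) (k : nat)
    (U : set 'rV[R]_n) (f : 'rV[R]_n -> W) : Prop :=
  match k with
  | 0 => forall x, U x -> {for x, continuous f}
  | k'.+1 => (forall x, U x -> differentiable f x) /\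
             (forall v : 'rV[R]_n, Ck k' U (fun x => 'D_v f x))
  end.

Definition smooth_on (R : realType) (n : nat) (W : normedModType R)
    (U : set 'rV[R]_n) (f : 'rV[R]_n -> W) : Prop :=
  forall k, Ck k U f.

(* [cmap] and [cinv] are total functions with arbitrary values outside
   [dom] and [cmap @` dom]. *)
Record chart (R : realType) (n : nat) (X : topologicalType) := Chart {
  dom : set X;
  cmap : X -> 'rV[R]_n;
  cinv : 'rV[R]_n -> X;
  dom_open : open dom;
  image_open : open (cmap @` dom);
  cmapK : forall p, dom p -> cinv (cmap p) = p;
  cmap_continuous : forall p, dom p -> {for p, continuous cmap};
  cinv_continuous : forall x, (cmap @` dom) x -> {for x, continuous cinv} }.

Definition transition (R : realType) (n : nat) (X : topologicalType)
  (a b : chart R n X) : 'rV[R]_n -> 'rV[R]_n := cmap b \o cinv a.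

Definition compatible (R : realType) (n : nat) (X : topologicalType)
    (a b : chart R n X) : Prop :=
  smooth_on (cmap a @` (dom a `&` dom b)) (transition a b).

Record manifold (R : realType) (n : nat) := Manifold {
  carrier :> topologicalType;
  atlas : set (chart R n carrier);
  manifold_hausdorff : hausdorff_space carrier;
  manifold_second_countable : @second_countable carrier;
  atlas_cover : forall p, exists2 a, atlas a & dom a p;
  atlas_compatible : forall a b, atlas a -> atlas b -> compatible a b;
  atlas_maximal : forall a,
    (forall b, atlas b -> compatible a b /\ compatible b a) -> atlas a }.

Record mchart (R : realType) (n : nat) (M : manifold R n) := MChart {
  mchart_val :> chart R n M;
  mchart_atlas : atlas mchart_val }.

Definition partial (R : realType) (n : nat) (X : topologicalType)
    (W : normedModType R) (c : chart R n X) (i : 'I_n) (f : X -> W) (p : X) : W :=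
  'D_('e_i) (f \o cinv c) (cmap c p).

Section NearEq.
Context {R : realType} {V W : normedModType R}.

Lemma near0_is_diff (h : V -> W) (x : V) :
  {near x, h =1 cst 0} -> is_diff x h (cst 0).
Proof.
move=> h0.
have ho : h \o shift x = cst (h x) + (\0 : {linear V -> W}) +o_ 0 id.
  apply/eqaddoP => _/posnumP[e]; near=> y => /=.
  rewrite [X in `|X|](_ : _ = 0) ?normr0//.
  rewrite !fctE (nbhs_singleton h0) /= addr0 subr0.
  by near: y; move: h0; rewrite (near_shift 0) /= subr0.
have c0 : continuous (\0 : {linear V -> W}) by move=> y; exact: cvg_cst.
have dh := diff_unique c0 ho.
by apply: DiffDef => //; apply/diff_locallyP; rewrite dh.
Unshelve. all: by end_near. Qed.

Lemma near_eq_is_diff (f g : V -> W) (x : V) :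
  {near x, f =1 g} -> differentiable f x -> is_diff x g ('d f x).
Proof.
move=> fg df.
have gfE : g = f + (g - f) by rewrite addrC subrK.
have d0 : is_diff x (g - f) (cst 0).
  by apply: near0_is_diff; apply: filterS fg => y /= fgy; rewrite !fctE fgy subrr.
have := is_diffD (differentiableP df) d0.
by rewrite -gfE addr0.
Qed.

End NearEq.

Section CkTheory.
Context {R : realType} {n : nat}.
Implicit Types U : set 'rV[R]_n.

Lemma Ck_congr (W : normedModType R) k U (f g : 'rV[R]_n -> W) :
  open U -> (forall x, U x -> f x = g x) -> Ck k U f -> Ck k U g.
Proof.
move=> oU; elim: k f g => [|k IH] f g fg /=;
  have nfg x (Ux : U x) : {near x, f =1 g} by
    apply: filterS (open_nbhs_nbhs (conj oU Ux)) => y /fg.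
  move=> cf x Ux; rewrite /prop_for /continuous_at -(fg _ Ux).
  exact: cvg_trans (near_eq_cvg (nfg _ Ux)) (cf _ Ux).
move=> [df dDf]; split=> [x Ux|v].
  by have [] := near_eq_is_diff (nfg _ Ux) (df _ Ux).
by apply: IH (dDf v) => x Ux; apply: near_eq_derive; exact: nfg.
Qed.

Lemma Ck0 (W : normedModType R) k U : Ck k U (fun=> 0 : W).
Proof.
elim: k => [|k IH] /=; first by move=> x _; exact: cst_continuous.
split=> [x _|v]; first exact: ex_diff.
by rewrite (_ : (fun x => _) = fun=> 0) //; apply/funext => x; rewrite derive_cst.
Qed.

Lemma CkD (W : normedModType R) k U (f g : 'rV[R]_n -> W) :
  open U -> Ck k U f -> Ck k U g -> Ck k U (fun x => f x + g x).
Proof.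
move=> oU; elim: k f g => [|k IH] f g /=.
  by move=> cf cg x Ux; exact: cvgD (cf _ Ux) (cg _ Ux).
move=> [df cf] [dg cg]; split=> [x Ux|v].
  exact: differentiableD (df _ Ux) (dg _ Ux).
apply: Ck_congr oU _ (IH _ _ (cf v) (cg v)) => x Ux /=.
by rewrite deriveD //; apply: diff_derivable; [exact: df|exact: dg].
Qed.

Lemma Ck_sum (W : normedModType R) (I : Type) (r : seq I) k U
    (f : I -> 'rV[R]_n -> W) :
  open U -> (forall i, Ck k U (f i)) -> Ck k U (fun x => \sum_(i <- r) f i x).
Proof.
move=> oU cf; elim: r => [|i r IH].
  by under eq_fun do rewrite big_nil; exact: Ck0.
by under eq_fun do rewrite big_cons; exact: CkD.
Qed.

Lemma Ck_linear (W W' : normedModType R) (L : {linear W -> W'}) k U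
    (f : 'rV[R]_n -> W) :
  open U -> continuous L -> Ck k U f -> Ck k U (L \o f).
Proof.
move=> oU cL; elim: k f => [|k IH] f /=.
  by move=> cf x Ux; apply: continuous_comp; [exact: cf|exact: cL].
move=> [df cf]; split=> [x Ux|v].
  by apply: differentiable_comp; [exact: df|exact: linear_differentiable].
apply: Ck_congr oU _ (IH _ (cf v)) => x Ux /=; have dfx := df _ Ux.
have dL y : differentiable L y by exact: linear_differentiable.
have dLf : differentiable (L \o f) x by exact: differentiable_comp.
rewrite (deriveE _ dLf) (deriveE _ dfx) (diff_comp dfx (dL _)) /=.
by rewrite (diff_lin _ cL).
Qed.

Lemma Ck_coef (m p m' p' : nat) K U (f : 'rV[R]_n -> 'M[R]_(m, p)) i j
    (C : 'M[R]_(m', p')) :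
  open U -> Ck K U f -> Ck K U (fun x => f x i j *: C).
Proof.
move=> oU.
have lin : linear (fun N : 'M[R]_(m, p) => N i j *: C).
  by move=> a N N'; rewrite !mxE scalerDl scalerA.
pose Lm := GRing.isLinear.Build _ _ _ _ _ lin.
pose L : {linear 'M[R]_(m, p) -> 'M[R]_(m', p')} :=
  HB.pack (fun N : 'M[R]_(m, p) => N i j *: C) Lm.
apply: (@Ck_linear _ _ L K U f oU) => N.
by apply: differentiable_continuous; apply: differentiableZl; exact: differentiable_coord.
Qed.

Lemma smooth_jacobian (m : nat) U (f : 'rV[R]_n -> 'rV[R]_m) :
  open U -> smooth_on U f -> smooth_on U (fun x => ('J f x)^T).
Proof.
move=> oU sf k; have [df cf] := sf k.+1.
have := @Ck_sum _ _ (index_enum 'I_n) k U _ oU (fun i =>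
  @Ck_sum _ _ (index_enum 'I_m) k U _ oU (fun j =>
  Ck_coef 0 j (delta_mx j i : 'M[R]_(m, n)) oU (cf 'e_i))).
apply: Ck_congr oU _ => x Ux; rewrite [RHS]matrix_sum_delta exchange_big /=.
apply: eq_bigr => i _; apply: eq_bigr => j _; congr (_ *: _).
by rewrite mxE /jacobian mxE deriveE //; exact: df.
Qed.

Lemma jacobian_comp (m p : nat) (f : 'rV[R]_n -> 'rV[R]_m)
    (g : 'rV[R]_m -> 'rV[R]_p) (h : 'rV[R]_n -> 'rV[R]_p) x :
  differentiable f x -> differentiable g (f x) -> {near x, g \o f =1 h} ->
  'J h x = 'J f x *m 'J g (f x).
Proof.
move=> df dg gfh.
have dh := near_eq_is_diff gfh (differentiable_comp df dg).
apply/row_matrixP => i; rewrite !rowE mulmxA /jacobian !mul_rV_lin1.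
by rewrite diff_val (diff_comp df dg).
Qed.

Lemma jacobian_near_id (f : 'rV[R]_n -> 'rV[R]_n) x :
  {near x, id =1 f} -> 'J f x = 1%:M.
Proof.
move=> idf; have df := near_eq_is_diff idf (@ex_diff _ _ _ _ _ _ _ (is_diff_id x)).
apply/row_matrixP => i; rewrite !rowE /jacobian mul_rV_lin1 mulmx1.
by rewrite diff_val diff_val.
Qed.

End CkTheory.

Section Transition.
Context {R : realType} {n : nat} {M : manifold R n}.
Implicit Types (a b c : mchart M) (p : M).

Lemma open_overlap (X : topologicalType) (a b : chart R n X) :
  open (cmap a @` (dom a `&` dom b)).
Proof.
rewrite openE => _ [p [ap bp] <-].
have ap' : (cmap a @` dom a) (cmap a p) by exists p.
have n1 := open_nbhs_nbhs (conj (@image_open _ _ _ a) ap').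
have n2 : nbhs (cmap a p) (cinv a @^-1` dom b).
  apply: (cinv_continuous ap'); rewrite cmapK //.
  exact: open_nbhs_nbhs (conj (@dom_open _ _ _ b) bp).
apply: filterS (filterI n1 n2) => _ [[q aq <-]] /=; rewrite cmapK // => bq.
by exists q.
Qed.

Lemma transition_differentiable a b p : dom a p -> dom b p ->
  differentiable (transition a b) (cmap a p).
Proof.
move=> ap bp; have [+ _] := atlas_compatible (mchart_atlas a) (mchart_atlas b) 1.
by apply; exists p.
Qed.

(* [tangent_trans a b p] is the matrix of entries dy^k/dx^l, k the row index,
   where x and y are the coordinates of [a] and [b]. *)
Definition tangent_trans a b p : 'M[R]_n :=
  ('J (transition a b) (cmap a p))^T.

Lemma tangent_trans_smooth a b :
  smooth_on (cmap a @` (dom a `&` dom b)) (tangent_trans a b \o cinv a).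
Proof.
have oU := @open_overlap _ a b.
have := smooth_jacobian oU (atlas_compatible (mchart_atlas a) (mchart_atlas b)).
move=> + k => /(_ k); apply: Ck_congr oU _ => _ [p [ap bp] <-] /=.
by rewrite cmapK.
Qed.

Lemma tangent_trans_comp a b c p : dom a p -> dom b p -> dom c p ->
  tangent_trans b c p *m tangent_trans a b p = tangent_trans a c p.
Proof.
move=> ap bp cp; rewrite /tangent_trans -trmx_mul; congr trmx.
have dab := transition_differentiable ap bp.
have dbc := transition_differentiable bp cp.
have tp : transition a b (cmap a p) = cmap b p by rewrite /transition /= cmapK.
have dbc' : differentiable (transition b c) (transition a b (cmap a p)).
  by rewrite tp.
have E : {near cmap a p, transition b c \o transition a b =1 transition a c}.
  have oU := @open_overlap _ a b.
  have Up : (cmap a @` (dom a `&` dom b)) (cmap a p) by exists p.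
  apply: filterS (open_nbhs_nbhs (conj oU Up)) => _ [q [aq bq] <-].
  by rewrite /transition /= cmapK // cmapK.
by rewrite -tp; apply: esym; exact: jacobian_comp dab dbc' E.
Qed.

Lemma tangent_trans_id a p : dom a p -> tangent_trans a a p = 1%:M.
Proof.
move=> ap; rewrite /tangent_trans -[RHS]trmx1; congr trmx.
have E : {near cmap a p, id =1 transition a a}.
  have Up : (cmap a @` dom a) (cmap a p) by exists p.
  apply: filterS (open_nbhs_nbhs (conj (@image_open _ _ _ a) Up)) => _ [q aq <-].
  by rewrite /transition /= cmapK.
exact: jacobian_near_id.
Qed.

End Transition.

(* A rank r vector bundle, presented by its transition cocycle.  A [frame] is
   a local frame over the domain of the chart [base]; the components s_a of a
   section, as column vectors, satisfy s_b = trans a b *m s_a. *)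
Record vbundle (R : realType) (n : nat) (M : manifold R n) (r : nat) := VBundle {
  frame : Type;
  base : frame -> mchart M;
  trans : frame -> frame -> M -> 'M[R]_r;
  base_cover : forall p, exists a, dom (base a) p;
  trans_smooth : forall a b,
    smooth_on (cmap (base a) @` (dom (base a) `&` dom (base b)))
              (trans a b \o cinv (base a));
  trans_id : forall a p, dom (base a) p -> trans a a p = 1%:M;
  trans_comp : forall a b c p,
    dom (base a) p -> dom (base b) p -> dom (base c) p ->
    trans b c p *m trans a b p = trans a c p }.

Lemma mchart_cover (R : realType) (n : nat) (M : manifold R n) (p : M) :
  exists a : mchart M, dom a p.
Proof. by have [a aM ap] := atlas_cover p; exists (MChart aM). Qed.

Definition tangent (R : realType) (n : nat) (M : manifold R n) : vbundle M n :=
  @VBundle R n M n (mchart M) id tangent_trans (@mchart_cover R n M)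
    tangent_trans_smooth tangent_trans_id tangent_trans_comp.

Record fiberMetric (R : realType) (n : nat) (M : manifold R n) (r : nat)
    (E : vbundle M r) := FiberMetric {
  fmetric :> frame E -> M -> 'M[R]_r;
  fmetric_smooth : forall a,
    smooth_on (cmap (base a) @` dom (base a)) (fmetric a \o cinv (base a));
  fmetric_sym : forall a p, dom (base a) p -> (fmetric a p)^T = fmetric a p;
  fmetric_nondeg : forall a p, dom (base a) p -> fmetric a p \in unitmx;
  fmetric_trans : forall a b p, dom (base a) p -> dom (base b) p ->
    fmetric a p = (trans a b p)^T *m fmetric b p *m trans a b p }.

Definition lorentzian (R : realType) (n : nat) (M : manifold R n)
    (g : fiberMetric (tangent M)) : Prop :=
  forall (a : mchart M) p, dom a p -> exists2 P : 'M[R]_n, P \in unitmx &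
    P^T *m g a p *m P = diag_mx (\row_(i < n) if i == 0%N :> nat then -1 else 1).

(* [conn a i] is the matrix of the connection 1-form along the i-th coordinate
   vector of [base a]:  nabla_i s = partial_i s + conn a i *m s.  The last field
   expresses that nabla s does not depend on the frame and coordinates. *)
Record connection (R : realType) (n : nat) (M : manifold R n) (r : nat)
    (E : vbundle M r) := Connection {
  conn :> frame E -> 'I_n -> M -> 'M[R]_r;
  conn_smooth : forall a i,
    smooth_on (cmap (base a) @` dom (base a)) (conn a i \o cinv (base a));
  conn_trans : forall a b i p, dom (base a) p -> dom (base b) p ->
    trans a b p *m conn a i p =
      partial (base a) i (trans a b) p +
      \sum_(k < n) tangent_trans (base a) (base b) p k i *:
        (conn b k p *m trans a b p) }.

Definition metric_compatible (R : realType) (n : nat) (M : manifold R n)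
    (r : nat) (E : vbundle M r) (h : fiberMetric E) (A : connection E) : Prop :=
  forall (a : frame E) (i : 'I_n) p, dom (base a) p ->
    partial (base a) i (h a) p = (A a i p)^T *m h a p + h a p *m A a i p.

Record metricConnection (R : realType) (n : nat) (M : manifold R n) (r : nat)
    (E : vbundle M r) (h : fiberMetric E) := MetricConnection {
  mconn :> connection E;
  mconn_compatible : metric_compatible h mconn }.

(* Gamma^k_{ij}, where nabla_i d_j = Gamma^k_{ij} d_k. *)
Definition christoffel (R : realType) (n : nat) (M : manifold R n)
    (D : connection (tangent M)) (a : mchart M) (p : M) (k i j : 'I_n) : R :=
  D a i p k j.

Record leviCivita (R : realType) (n : nat) (M : manifold R n)
    (g : fiberMetric (tangent M)) := LeviCivita {
  levi_civita :> metricConnection g;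
  torsion_free : forall (a : mchart M) p (k i j : 'I_n), dom a p ->
    christoffel levi_civita a p k i j = christoffel levi_civita a p k j i }.

(* nabla_i nabla_j s - nabla_j nabla_i s = curvature A a i j p *m s. *)
Definition curvature (R : realType) (n : nat) (M : manifold R n) (r : nat)
    (E : vbundle M r) (A : connection E) (a : frame E) (i j : 'I_n) (p : M)
    : 'M[R]_r :=
  partial (base a) i (A a j) p - partial (base a) j (A a i) p
  + A a i p *m A a j p - A a j p *m A a i p.

(* R^k_{lij} *)
Definition riemann (R : realType) (n : nat) (M : manifold R n)
    (D : connection (tangent M)) (a : mchart M) (p : M) (k l i j : 'I_n) : R :=
  curvature D a i j p k l.

Definition ricci (R : realType) (n : nat) (M : manifold R n)
    (D : connection (tangent M)) (a : mchart M) (p : M) : 'M[R]_n :=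
  \matrix_(i, j) \sum_(k < n) riemann D a p k i k j.

Definition scalar_curvature (R : realType) (n : nat) (M : manifold R n)
    (g : fiberMetric (tangent M)) (D : connection (tangent M))
    (a : mchart M) (p : M) : R :=
  \sum_(i < n) \sum_(j < n) invmx (g a p) i j * ricci D a p i j.

Definition energy_momentum (R : realType) (n : nat) (M : manifold R n)
    (g : fiberMetric (tangent M)) (D : connection (tangent M))
    (a : mchart M) (p : M) : 'M[R]_n :=
  ricci D a p - (2^-1 * scalar_curvature g D a p) *: g a p.

(* nabla_k T_{ij} *)
Definition nabla_tensor2 (R : realType) (n : nat) (M : manifold R n)
    (D : connection (tangent M)) (T : mchart M -> M -> 'M[R]_n)
    (a : mchart M) (p : M) (k i j : 'I_n) : R :=
  partial a k (T a) p i j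
  - \sum_(l < n) christoffel D a p l k i * T a p l j
  - \sum_(l < n) christoffel D a p l k j * T a p i l.

Definition class_Omega2 (R : realType) (n : nat) (M : manifold R n)
    (g : fiberMetric (tangent M)) (D : leviCivita g) : Prop :=
  let T := energy_momentum g D in
  forall (a : mchart M) p (i j k : 'I_n), dom a p ->
    nabla_tensor2 D T a p k i j = nabla_tensor2 D T a p i k j.

(* nabla_m F_{ij} for an End(E)-valued 2-form F, with components F a i j p in
   the frame a; the covariant derivative couples A (acting on End(E) by the
   commutator) with the connection D of the base. *)
Definition nabla_endform (R : realType) (n : nat) (M : manifold R n) (r : nat)
    (E : vbundle M r) (D : connection (tangent M)) (A : connection E)
    (F : frame E -> 'I_n -> 'I_n -> M -> 'M[R]_r)
    (a : frame E) (m i j : 'I_n) (p : M) : 'M[R]_r :=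
  partial (base a) m (F a i j) p
  + (A a m p *m F a i j p - F a i j p *m A a m p)
  - \sum_(k < n) christoffel D (base a) p k m i *: F a k j p
  - \sum_(k < n) christoffel D (base a) p k m j *: F a i k p.

(* (d^* F)_j = - g^{mi} nabla_m F_{ij} *)
Definition codifferential (R : realType) (n : nat) (M : manifold R n) (r : nat)
    (E : vbundle M r) (g : fiberMetric (tangent M)) (D : connection (tangent M))
    (A : connection E) (F : frame E -> 'I_n -> 'I_n -> M -> 'M[R]_r)
    (a : frame E) (j : 'I_n) (p : M) : 'M[R]_r :=
  - \sum_(m < n) \sum_(i < n)
      invmx (g (base a) p) m i *: nabla_endform D A F a m i j p.

Definition yang_mills (R : realType) (n : nat) (M : manifold R n) (r : nat)
    (g : fiberMetric (tangent M)) (D : leviCivita g)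
    (E : vbundle M r) (gE : fiberMetric E) (A : metricConnection gE) : Prop :=
  forall (a : frame E) (j : 'I_n) p, dom (base a) p ->
    codifferential g D A (curvature A) a j p = 0.

(* Main.v *)
(* Contracting the second Bianchi identity once, and using the pair symmetry of
   the curvature, turns d^* R = 0 into the symmetry of nabla_k R_ij in k and i.
   Contracting it twice gives div Ric = ds/2.  Tracing either nabla_k R_ij =
   nabla_i R_kj or nabla_k T_ij = nabla_i T_kj then forces ds = 0 (for T this
   uses n != 2), and when ds = 0 the two conditions coincide.

   The identities are proved at a point of a chart.  The Bianchi identities and
   the skew symmetry of R, which rest on the commutation of second partial
   derivatives, yield four linear identities between the components of nabla R;
   the rest is finite-dimensional algebra. *)

Require Import Defs.
From mathcomp Require Import all_boot all_order all_algebra.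
From mathcomp Require Import all_classical all_reals all_analysis.
From mathcomp Require Import ring lra.

Set Implicit Arguments.
Unset Strict Implicit.
Unset Printing Implicit Defensive.

Import Order.TTheory GRing.Theory Num.Theory.
Import numFieldNormedType.Exports.

Local Open Scope classical_set_scope.
Local Open Scope ring_scope.

(** * Pointwise algebra: pair symmetry, contracted Bianchi identities, Codazzi conditions *)

(* [N m i j k l] stands for nabla_m R^k_{lij} at a point and [L m k l i j] for
   nabla_m R_{klij}, so that [rho k i j] is nabla_k R_ij, [sigma] is ds and
   [div] is the divergence of Ric. *)
Section BianchiAlgebra.
Context {K : realFieldType} {n : nat}.
Variables (G : 'M[K]_n) (N : 'I_n -> 'I_n -> 'I_n -> 'M[K]_n).
Hypothesis G_sym : G^T = G.
Hypothesis G_unit : G \in unitmx.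
Hypothesis N_skew : forall m i j, N m j i = - N m i j.
Hypothesis N_metric : forall m i j, (G *m N m i j)^T = - (G *m N m i j).
Hypothesis N_bianchi1 : forall m k l i j,
  N m i j k l + N m j l k i + N m l i k j = 0.
Hypothesis N_bianchi2 : forall m i j, N m i j + N i j m + N j m i = 0.

Let H := invmx G.
Let L m k l i j := (G *m N m i j) k l.
Let rho k i j := \sum_l N k l j l i.
Let sigma k := \sum_i \sum_j H i j * rho k i j.
Let div k := \sum_i \sum_j H i j * rho i j k.

Let H_sym i j : H i j = H j i.
Proof. by rewrite /H -[in LHS]G_sym -trmx_inv mxE. Qed.

Let G_symE i j : G i j = G j i.
Proof. by rewrite -[in LHS]G_sym mxE. Qed.

Let L_skew m k l i j : L m k l j i = - L m k l i j.
Proof. by rewrite /L N_skew mulmxN mxE. Qed.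

Let L_metric m k l i j : L m l k i j = - L m k l i j.
Proof. by move: (N_metric m i j) => /matrixP/(_ k l); rewrite mxE [RHS]mxE. Qed.

Let L_bianchi1 m k l i j : L m k l i j + L m k i j l + L m k j l i = 0.
Proof.
rewrite /L !mxE -!big_split big1 // => a _ /=.
by rewrite -!mulrDr N_bianchi1 mulr0.
Qed.

(** Octahedron argument: four cyclic identities, one for each choice of the leading index among [k],
    [l], [i], [j], are combined with skewness within each pair. *)
Lemma lowered_pair_sym m k l i j : L m k l i j = L m i j k l.
Proof.
have := L_bianchi1 m k l i j; have := L_bianchi1 m l i j k.
have := L_bianchi1 m i j k l; have := L_bianchi1 m j k l i.
have := L_metric m k l i j; have := L_metric m i j k l.
have := L_metric m k i j l; have := L_skew m i k j l.
have := L_metric m l j k i; have := L_skew m j l k i.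
have := L_metric m k j l i; have := L_metric m l i j k.
lra.
Qed.

Let raise m j k l a : \sum_i H a i * L m i l j k = N m j k a l.
Proof.
have -> : N m j k = H *m (G *m N m j k) by rewrite mulmxA mulVmx ?mul1mx.
by rewrite mxE.
Qed.

Let rhoE m i j : rho m i j = \sum_a \sum_b H a b * L m b i a j.
Proof. by apply: eq_bigr => a _; rewrite raise. Qed.

(** Follows from pair symmetry of the lowered curvature and the symmetry of the inverse metric. *)
Lemma contraction_sym m i j : rho m i j = rho m j i.
Proof.
rewrite !rhoE exchange_big /=; apply: eq_bigr => a _; apply: eq_bigr => b _.
by rewrite H_sym lowered_pair_sym.
Qed.

(** Trace of [N_bianchi2] over the upper index and the index of differentiation; the other two
    traces are Ricci terms, one of them after a skew flip. *)
Lemma contracted_bianchi i j l :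
  \sum_k N k i j k l = rho i l j - rho j l i.
Proof.
have : \sum_k (N k i j k l + N i j k k l + N j k i k l) = 0.
  rewrite big1 // => k _.
  by have /matrixP/(_ k l) := N_bianchi2 k i j; rewrite !mxE.
rewrite !big_split /= => /eqP; rewrite -addrA addr_eq0 => /eqP ->.
rewrite opprD -!sumrN; congr (_ + _).
by apply: eq_bigr => k _; rewrite [in LHS]N_skew mxE opprK.
Qed.

(** Pair symmetry moves the divergence from a form index to the upper index, where
    [contracted_bianchi] evaluates it. *)
Lemma lowered_divergence j k l :
  (G *m \sum_m \sum_i H m i *: N m i j) k l = rho k j l - rho l j k.
Proof.
rewrite -contracted_bianchi mulmx_sumr summxE; apply: eq_bigr => m _.
rewrite mulmx_sumr summxE -raise; apply: eq_bigr => i _.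
by rewrite -scalemxAr mxE lowered_pair_sym.
Qed.

Lemma divergence_eq0P :
  (forall j, \sum_m \sum_i H m i *: N m i j = 0) <->
  (forall j k l, rho k j l = rho l j k).
Proof.
split=> [E j k l|E j].
  by apply/eqP; rewrite -subr_eq0 -lowered_divergence E mulmx0 mxE.
have : G *m \sum_m \sum_i H m i *: N m i j = 0.
  by apply/matrixP => k l; rewrite lowered_divergence E subrr mxE.
by move/(congr1 (mulmx H)); rewrite mulmxA mulVmx // mul1mx mulmx0.
Qed.

Lemma div_contraction k : div k = \sum_i \sum_j H i j * rho i k j.
Proof.
by apply: eq_bigr => i _; apply: eq_bigr => j _; rewrite contraction_sym.
Qed.

Lemma twice_contracted_bianchi k : sigma k = div k *+ 2.
Proof.
(* The left side of [E] expands to [sigma k - div k], so [E] is the claim in another form. *)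
suff E : \sum_j \sum_l H j l * (rho k j l - rho l j k) = div k.
  rewrite mulr2n -{1}E; under eq_bigr => j _ do under eq_bigr do rewrite mulrBr.
  under eq_bigr do rewrite sumrB; rewrite sumrB /div [X in _ - X + _]exchange_big /=.
  rewrite -addrA [X in _ + X](_ : _ = 0) ?addr0 //.
  apply/eqP; rewrite addrC subr_eq0; apply/eqP.
  by apply: eq_bigr => i _; apply: eq_bigr => j _; rewrite H_sym.
(* Both sides are the contraction of [L m i j k l] with two copies of [H]; on the [div] side the
   skew symmetries in the two pairs contribute signs that cancel. *)
transitivity (\sum_m \sum_i \sum_l \sum_j H m i * (H l j * L m i j k l)).
  transitivity (\sum_l \sum_j \sum_m \sum_i H m i * (H l j * L m i j k l)).
    rewrite exchange_big; apply: eq_bigr => l _; apply: eq_bigr => j _.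
    rewrite -contracted_bianchi mulr_sumr; apply: eq_bigr => m _.
    by rewrite -raise mulr_sumr; apply: eq_bigr => i _; rewrite H_sym mulrCA.
  under eq_bigr => l _ do rewrite exchange_big.
  rewrite exchange_big; apply: eq_bigr => m _ /=.
  under eq_bigr => l _ do rewrite exchange_big.
  by rewrite exchange_big.
apply: eq_bigr => m _; apply: eq_bigr => i _; rewrite mulr_sumr.
apply: eq_bigr => l _; rewrite -raise mulr_sumr; apply: eq_bigr => j _.
by rewrite L_skew L_metric opprK.
Qed.

(** The trace of the Codazzi condition gives [sigma k = div k], whereas the twice contracted Bianchi
    identity gives [sigma k = div k *+ 2]. *)
Lemma trace_div_eq0 :
  (forall i j k, rho k i j = rho i k j) -> forall k, sigma k = 0.
Proof.
move=> E k; have : sigma k = div k.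
  rewrite div_contraction /sigma; apply: eq_bigr => i _.
  by apply: eq_bigr => j _; rewrite E.
rewrite twice_contracted_bianchi; lra.
Qed.

Lemma trace_metric : \sum_i \sum_j H i j * G i j = n%:R.
Proof.
rewrite -(@mxtrace1 K n) -(mulVmx G_unit) /mxtrace; apply: eq_bigr => i _.
by rewrite mxE; apply: eq_bigr => j _; rewrite G_symE.
Qed.

(** Tracing the first condition over [i] and [j] gives sigma - n sigma / 2 = div - sigma / 2;
    substituting sigma = 2 div leaves (2 - n) div = 0. In the other direction [trace_div_eq0]
    removes the extra terms. *)
Lemma codazzi_trace_reversed : n != 2 ->
  (forall i j k, rho k i j - 2^-1 * sigma k * G i j
               = rho i k j - 2^-1 * sigma i * G k j) <->
  (forall i j k, rho k i j = rho i k j).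
Proof.
move=> n2; split=> E; last first.
  by move=> i j k; rewrite E !trace_div_eq0 // !mulr0 !mul0r.
suff sigma0 k : sigma k = 0.
  by move=> i j k; have := E i j k; rewrite !sigma0 !mulr0 !mul0r !subr0.
have : \sum_i \sum_j H i j * (rho k i j - 2^-1 * sigma k * G i j)
     = \sum_i \sum_j H i j * (rho i k j - 2^-1 * sigma i * G k j).
  by apply: eq_bigr => i _; apply: eq_bigr => j _; rewrite E.
have -> : \sum_i \sum_j H i j * (rho k i j - 2^-1 * sigma k * G i j)
    = sigma k - 2^-1 * sigma k * n%:R.
  under eq_bigr => i _ do under eq_bigr do rewrite mulrBr mulrCA.
  under eq_bigr => i _ do rewrite sumrB -mulr_sumr.
  by rewrite sumrB -mulr_sumr trace_metric.
have -> : \sum_i \sum_j H i j * (rho i k j - 2^-1 * sigma i * G k j)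
    = div k - 2^-1 * sigma k.
  rewrite div_contraction.
  under eq_bigr => i _ do under eq_bigr do rewrite mulrBr mulrCA.
  under eq_bigr => i _ do rewrite sumrB -mulr_sumr.
  rewrite sumrB; congr (_ - _).
  have HG i : \sum_j H i j * G k j = (i == k)%:R.
    have /matrixP/(_ i k) := mulVmx G_unit; rewrite !mxE => <-.
    by apply: eq_bigr => j _; rewrite G_symE.
  under eq_bigr => i _ do rewrite HG.
  rewrite (bigD1 k) //= big1 ?addr0 => [|i /negPf ->]; last by rewrite mulr0.
  by rewrite eqxx mulr1.
rewrite twice_contracted_bianchi => E'.
have /eqP : div k * (2 - n%:R) = 0 by move: E'; lra.
rewrite mulf_eq0 => /orP[/eqP -> //|]; first by rewrite mul0rn.
by rewrite subr_eq0 eqr_nat eq_sym (negPf n2).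
Qed.

Lemma codazzi_div_free : n != 2 ->
  (forall i j k, rho k i j - 2^-1 * sigma k * G i j
               = rho i k j - 2^-1 * sigma i * G k j) <->
  (forall j, \sum_m \sum_i H m i *: N m i j = 0).
Proof.
move=> n2; apply: (iff_trans (codazzi_trace_reversed n2)).
apply: (iff_trans _ (iff_sym divergence_eq0P)).
(* The two conditions exchange the derivative index with different Ricci indices; the symmetry of
   [rho] in its last two arguments reconciles them. *)
by split=> E i j k; rewrite contraction_sym E contraction_sym.
Qed.

End BianchiAlgebra.

(** * Symmetry of mixed second directional derivatives *)

Section Schwarz.
Context {R : realType} {V : normedModType R}.
Implicit Types (f : V -> R) (x u v : V).

Lemma is_derive_line f x u (t : R) : derivable f (t *: u + x) u ->
  is_derive t 1 (fun s => f (s *: u + x)) ('D_u f (t *: u + x)).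
Proof.
move=> df; suff E : (fun h : R => h^-1 *:
    (((fun s => f (s *: u + x)) \o shift t) (h *: 1) - f (t *: u + x))) =
    fun h => h^-1 *: ((f \o shift (t *: u + x)) (h *: u) - f (t *: u + x)).
  by split; rewrite /derivable /derive E.
by apply/funext => h /=; rewrite -[h *: 1]/(h * 1) mulr1 scalerDl addrA.
Qed.

Lemma MVT_line f fu x u (h : R) : 0 < h ->
  (forall t : R, 0 <= t <= h -> is_derive (t *: u + x) u f (fu (t *: u + x))) ->
  exists2 t : R, 0 <= t <= h & f (h *: u + x) - f x = h * fu (t *: u + x).
Proof.
move=> h0 df; have df' t : 0 <= t <= h ->
    is_derive t 1 (fun s => f (s *: u + x)) (fu (t *: u + x)).
  by move=> /df dft; rewrite -(derive_val (is_derive := dft)); exact: is_derive_line.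
have [t|t|t th E] := @MVT _ (fun s => f (s *: u + x))
    (fun s => fu (s *: u + x)) 0 h h0.
- by rewrite in_itv /= => /andP[t0 th]; apply: df'; rewrite !ltW.
- apply: derivable_within_continuous => s; rewrite in_itv /= => /df' ds.
  exact: ex_derive.
exists t; first by move: th; rewrite in_itv /= => /andP[t0 th]; rewrite !ltW.
by move: E; rewrite scale0r add0r subr0 mulrC.
Qed.

(** The mean value theorem is applied twice: along [u] to the increment [f (h *: v + y) - f y], then
    along [v] to [fu]. *)
Lemma second_difference f fu fuv x u v (h : R) : 0 < h ->
  (forall s t : R, 0 <= s <= h -> 0 <= t <= h ->
    let y := s *: u + (t *: v + x) in
    is_derive y u f (fu y) /\ is_derive y v fu (fuv y)) ->
  exists s t : R, [/\ 0 <= s <= h, 0 <= t <= h &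
    f (h *: u + (h *: v + x)) - f (h *: u + x) - (f (h *: v + x) - f x) =
    h * (h * fuv (s *: u + (t *: v + x)))].
Proof.
move=> h0 df; have hh : 0 <= h <= h by rewrite ltW //=.
have h00 : (0 : R) <= 0 <= h by rewrite (ltW h0) andbT.
pose phi y := f (h *: v + y) - f y; pose phiu y := fu (h *: v + y) - fu y.
have dphi (t : R) : 0 <= t <= h -> is_derive (t *: u + x) u phi (phiu (t *: u + x)).
  move=> th; have [d1 _] := df _ _ th hh; have [d0 _] := df _ _ th h00.
  rewrite scale0r add0r in d0; rewrite addrCA in d1.
  have E : is_derive (t *: u + x) u (fun y => f (h *: v + y))
      (fu (h *: v + (t *: u + x))).
    have e : (fun k : R => k^-1 *: (((fun y => f (h *: v + y)) \o
        shift (t *: u + x)) (k *: u) - f (h *: v + (t *: u + x)))) =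
        fun k => k^-1 *: ((f \o shift (h *: v + (t *: u + x))) (k *: u)
          - f (h *: v + (t *: u + x))).
      by apply/funext => k /=; rewrite addrCA.
    by case: d1 => d1 <-; split; rewrite /derivable /derive e.
  exact: is_deriveB E d0.
have [t th Et] := MVT_line h0 dphi.
have [s|s sh Es] := @MVT_line fu fuv (t *: u + x) v h h0.
  by move=> sh; have [_] := df _ _ th sh; rewrite addrCA.
exists t, s; split=> //; rewrite /phi in Et.
rewrite [h *: u + (_ + x)]addrCA {}Et /phiu; congr (_ * _).
by rewrite Es addrCA.
Qed.

Lemma segment_nbhs (P : set V) x u v : nbhs x P ->
  exists2 h : R, 0 < h & forall s t : R, 0 <= s <= h -> 0 <= t <= h ->
    P (s *: u + (t *: v + x)).
Proof.
move=> /nbhs_normP[e /= e0 eP].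
have c0 : 0 < `|u| + `|v| + 1 by rewrite ltr_pwDr // addr_ge0.
(* With this [h] the displacement has norm below [e]; the added 1 keeps the denominator positive
   when [u] and [v] both vanish. *)
exists (e / 2 / (`|u| + `|v| + 1)) => [|s t /andP[s0 sh] /andP[t0 th]].
  by rewrite !divr_gt0.
apply: eP => /=; rewrite distrC addrA addrK.
apply: le_lt_trans (ler_normD _ _) _; rewrite !normrZ !ger0_norm //.
have -> : e = e / (`|u| + `|v| + 1) * (`|u| + `|v| + 1).
  by rewrite divfK // gt_eqF.
set k := e / _; have k0 : 0 < k by rewrite divr_gt0.
have hE : e / 2 / (`|u| + `|v| + 1) = k / 2 by rewrite mulrAC.
rewrite {}hE in sh th.
have := ler_wpM2r (normr_ge0 u) sh; have := ler_wpM2r (normr_ge0 v) th.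
have := mulr_ge0 (ltW k0) (normr_ge0 u); have := mulr_ge0 (ltW k0) (normr_ge0 v).
lra.
Qed.

(** The second difference is symmetric in [u] and [v], so [fuv] and [fvu] take a common value at two
    points arbitrarily close to [x]; continuity at [x] then bounds their difference there by any
    positive [e]. *)
Lemma mixed_derive_eq f fu fv fuv fvu x u v :
  (\forall y \near x, is_derive y u f (fu y) /\ is_derive y v fu (fuv y)) ->
  (\forall y \near x, is_derive y v f (fv y) /\ is_derive y u fv (fvu y)) ->
  {for x, continuous fuv} -> {for x, continuous fvu} -> fuv x = fvu x.
Proof.
move=> nu nv cuv cvu; apply/eqP; rewrite -subr_eq0 -normr_le0.
apply/ler_addgt0Pr => e e0; rewrite add0r.
have e20 : 0 < e / 2 by rewrite divr_gt0.
have n1 : \forall y \near x, `|fuv x - fuv y| < e / 2.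
  by move/cvgrPdist_lt/(_ _ e20): cuv.
have n2 : \forall y \near x, `|fvu x - fvu y| < e / 2.
  by move/cvgrPdist_lt/(_ _ e20): cvu.
have [h h0 hP] := segment_nbhs u v (filterI (filterI nu nv) (filterI n1 n2)).
have [|s [t [sh th E]]] := @second_difference f fu fuv x u v h h0.
  by move=> s t sh th; have [[]] := hP _ _ sh th.
have [|t' [s' [th' sh' E']]] := @second_difference f fv fvu x v u h h0.
  by move=> t' s' th' sh'; rewrite addrCA; have [[]] := hP _ _ sh' th'.
have [_ [+ _]] := hP _ _ sh th; have [_ [_]] := hP _ _ sh' th'.
have {E E'} -> : fuv (s *: u + (t *: v + x)) = fvu (s' *: u + (t' *: v + x)).
  apply: (mulfI (lt0r_neq0 h0)); apply: (mulfI (lt0r_neq0 h0)).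
  rewrite -E [s' *: u + _]addrCA -E' [h *: v + (_ + x)]addrCA; ring.
move=> d2 d1; rewrite (splitr e) -(subrKA (fvu (s' *: u + (t' *: v + x)))).
by rewrite (le_trans (ler_normD _ _)) // lerD // ltW // distrC.
Qed.

End Schwarz.

(** * Differentiation rules for matrix-valued functions *)

Section MatrixDerivative.
Context {R : realType} {V : normedModType R}.
Implicit Types (x v : V) (m n p : nat).

Lemma is_derive_mxP m n (F : V -> 'M[R]_(m, n)) D x v :
  is_derive x v F D <-> forall i j, is_derive x v (fun y => F y i j) (D i j).
Proof.
split=> [[/[dup] dF /derivable_mxP dFij <-] i j|dF].
  by rewrite derive_mx // mxE; exact: derivableP.
have dFx : derivable F x v by apply/derivable_mxP => i j; exact: ex_derive.
split=> //; rewrite derive_mx //; apply/matrixP => i j.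
by rewrite mxE derive_val.
Qed.

Lemma is_derive_bigsum (I : Type) (r : seq I) (f : I -> V -> R) df x v :
  (forall i, is_derive x v (f i) (df i)) ->
  is_derive x v (fun y => \sum_(i <- r) f i y) (\sum_(i <- r) df i).
Proof.
move=> df_; elim: r => [|i r IH].
  by under eq_fun do rewrite big_nil; rewrite big_nil; exact: is_derive_cst.
by under eq_fun do rewrite big_cons; rewrite big_cons; exact: is_deriveD.
Qed.

Lemma is_derive_mul (f g : V -> R) df dg x v :
  is_derive x v f df -> is_derive x v g dg ->
  is_derive x v (fun y => f y * g y) (df * g x + f x * dg).
Proof.
move=> hf hg; apply: is_derive_eq (is_deriveM hf hg) _.
by rewrite addrC mulrC.
Qed.

Lemma is_derive_mulmx m n p (F : V -> 'M[R]_(m, n)) (G : V -> 'M[R]_(n, p))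
    dF dG x v :
  is_derive x v F dF -> is_derive x v G dG ->
  is_derive x v (fun y => F y *m G y) (dF *m G x + F x *m dG).
Proof.
move=> /is_derive_mxP hF /is_derive_mxP hG; apply/is_derive_mxP => i j.
under eq_fun do rewrite mxE; rewrite !mxE -big_split /=.
by apply: is_derive_bigsum => k; exact: is_derive_mul.
Qed.

Lemma is_derive_trmx m n (F : V -> 'M[R]_(m, n)) dF x v :
  is_derive x v F dF -> is_derive x v (fun y => (F y)^T) dF^T.
Proof.
move=> /is_derive_mxP hF; apply/is_derive_mxP => i j.
by under eq_fun do rewrite mxE; rewrite mxE.
Qed.

Lemma is_derive_scalemx m n (c : V -> R) (F : V -> 'M[R]_(m, n)) dc dF x v :
  is_derive x v c dc -> is_derive x v F dF ->
  is_derive x v (fun y => c y *: F y) (dc *: F x + c x *: dF).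
Proof.
move=> hc /is_derive_mxP hF; apply/is_derive_mxP => i j.
by under eq_fun do rewrite mxE; rewrite !mxE; exact: is_derive_mul.
Qed.

Lemma derivable_bigprod (I : Type) (r : seq I) (f : I -> V -> R) x v :
  (forall i, derivable (f i) x v) -> derivable (fun y => \prod_(i <- r) f i y) x v.
Proof.
move=> df; elim: r => [|i r IH].
  by under eq_fun do rewrite big_nil; exact: derivable_cst.
by under eq_fun do rewrite big_cons; exact: derivableM.
Qed.

Lemma derivable_det n (F : V -> 'M[R]_n) x v :
  derivable F x v -> derivable (fun y => \det (F y)) x v.
Proof.
move=> /derivable_mxP dF; apply: ex_derive; apply: is_derive_bigsum => s.
apply: derivableP; apply: derivableM; first exact: derivable_cst.
exact: derivable_bigprod.
Qed.

Lemma derivable_adj n (F : V -> 'M[R]_n) x v :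
  derivable F x v -> derivable (fun y => \adj (F y)) x v.
Proof.
move=> /derivable_mxP dF; apply/derivable_mxP => i j.
under eq_fun do rewrite mxE /cofactor.
apply: derivableM; first exact: derivable_cst.
apply: derivable_det; apply/derivable_mxP => k l.
by under eq_fun do rewrite 2!mxE; exact: dF.
Qed.

(** Derivability comes from the adjugate formula, valid near [x]; the value is then found by
    differentiating the constant product of [F] with its inverse. *)
Lemma is_derive_invmx n (F : V -> 'M[R]_n) dF x v :
  (\forall y \near x, F y \in unitmx) -> is_derive x v F dF ->
  is_derive x v (fun y => invmx (F y)) (- (invmx (F x) *m dF *m invmx (F x))).
Proof.
move=> uF hF; have dF_ : derivable F x v by exact: ex_derive.
have uFx := nbhs_singleton uF.
have dI : derivable (fun y => invmx (F y)) x v.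
  have : derivable (fun y => (\det (F y))^-1 *: \adj (F y)) x v.
    apply: ex_derive; apply: is_derive_scalemx; apply: derivableP.
      apply: derivableV; last exact: derivable_det.
      by rewrite -unitfE -unitmxE.
    exact: derivable_adj.
  apply: near_eq_derivable; apply: filterS uF => y uFy.
  by rewrite /invmx uFy.
split=> //; set dI_ := 'D_v _ x.
have := is_derive_mulmx hF (derivableP dI).
move=> /(@derive_val _ _ _ _ _ _ _).
rewrite (near_eq_derive (g := cst 1%:M)) ?derive_cst; last first.
  by apply: filterS uF => y uFy; rewrite mulmxV.
move=> /eqP; rewrite eq_sym addrC addr_eq0 => /eqP /(congr1 (mulmx (invmx (F x)))).
by rewrite mulmxA mulVmx // mul1mx mulmxN mulmxA.
Qed.

End MatrixDerivative.

(** * Commuting derivatives of smooth matrix-valued maps *)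

Section SmoothMatrix.
Context {R : realType} {n : nat}.

(** Smoothness of order 2 supplies differentiable first derivatives and continuous second ones, so
    [mixed_derive_eq] applies to each entry. *)
Lemma derive_comm_mx (m p : nat) (F : 'rV[R]_n -> 'M[R]_(m, p)) U x u v :
  open U -> smooth_on U F -> U x -> 'D_v ('D_u F) x = 'D_u ('D_v F) x.
Proof.
move=> oU /(_ 2) [dF ddF] Ux; have nU : nbhs x U by exact: open_nbhs_nbhs.
have dij k l w y : U y ->
    is_derive y w (fun z => F z k l) ('D_w F y k l).
  move=> Uy; move: k l; apply/is_derive_mxP; apply: derivableP.
  by apply: diff_derivable; exact: dF.
have ddij k l w w' y : U y ->
    is_derive y w' (fun z => 'D_w F z k l) ('D_w' ('D_w F) y k l).
  move=> Uy; move: k l; apply/is_derive_mxP; apply: derivableP.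
  by apply: diff_derivable; have [+ _] := ddF w; exact.
have cij k l w w' : {for x, continuous (fun y => 'D_w' ('D_w F) y k l)}.
  have [_ /(_ w' x Ux) c] := ddF w.
  apply: (@continuous_comp _ _ _ ('D_w' ('D_w F)) (fun N : 'M[R]_(m, p) => N k l)) => //.
  by apply: differentiable_continuous; exact: differentiable_coord.
apply/matrixP => k l.
apply: (@mixed_derive_eq _ _ (fun y => F y k l) (fun y => 'D_u F y k l)
  (fun y => 'D_v F y k l) (fun y => 'D_v ('D_u F) y k l)
  (fun y => 'D_u ('D_v F) y k l) x u v) => //.
- by apply: filterS nU => y Uy; split; [exact: dij|exact: ddij].
- by apply: filterS nU => y Uy; split; [exact: dij|exact: ddij].
Qed.

End SmoothMatrix.

(* Unlike [mxE], these leave products of matrices folded. *)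
Lemma addmxE (R : pzRingType) m n (A B : 'M[R]_(m, n)) i j :
  (A + B) i j = A i j + B i j.
Proof. by rewrite mxE. Qed.

Lemma oppmxE (R : pzRingType) m n (A : 'M[R]_(m, n)) i j : (- A) i j = - A i j.
Proof. by rewrite mxE. Qed.

Lemma trmxD (R : pzRingType) m n (A B : 'M[R]_(m, n)) : (A + B)^T = A^T + B^T.
Proof. exact: raddfD. Qed.

Lemma trmxN (R : pzRingType) m n (A : 'M[R]_(m, n)) : (- A)^T = - A^T.
Proof. exact: raddfN. Qed.

(* The summands are turned into variables first, as comparing them by unfolding
   [partial] is very slow. *)
Ltac linear_mx :=
  repeat match goal with
  | |- context [partial _ _ _ _] => move: (partial _ _ _ _) => ?
  | |- context [@curvature ?R ?n ?M ?r ?E ?A ?a ?i ?j ?p] =>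
      generalize (@curvature R n M r E A a i j p); intro
  | |- context [@conn ?R ?n ?M ?r ?E ?A ?a ?i ?p] =>
      generalize (@conn R n M r E A a i p); intro
  | |- context [bigop.body _ _ _] => move: (bigop.body _ _ _) => ?
  end;
  repeat match goal with |- context [mulmx _ _] => move: (mulmx _ _) => ?
  end;
  let k := fresh "k" in let l := fresh "l" in
  match goal with
  | |- _ -> _ => let H := fresh in intro H; apply/matrixP; intros k l;
      generalize (congr1 (fun X => fun_of_matrix X k l) H); cbv beta; clear H
  | |- _ => apply/matrixP; intros k l
  end;
  rewrite !(addmxE, oppmxE) ?mxE; lra.

Lemma mxtrace_mul_tr (R : comPzRingType) n (A B : 'M[R]_n) :
  \tr (A^T *m B) = \sum_i \sum_j A i j * B i j.
Proof.
rewrite exchange_big; apply: eq_bigr => j _; rewrite mxE.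
by apply: eq_bigr => i _; rewrite mxE.
Qed.

(** * Partial derivatives in a chart *)

Section ChartDerivative.
Context {R : realType} {n : nat} {X : topologicalType}.
Variable a : chart R n X.
Implicit Types (p : X) (W : normedModType R).

Definition smooth_in_chart W (F : X -> W) :=
  smooth_on (cmap a @` dom a) (F \o cinv a).

(** [partial] is total and meaningful only for derivable functions; this predicate records existence
    along with the value, and unfolds to [is_derive] so that the rules above apply. *)
Definition has_partial W (i : 'I_n) (F : X -> W) p (dF : W) :=
  is_derive (cmap a p) 'e_i (F \o cinv a) dF.

Lemma partialE W i (F : X -> W) p dF : has_partial i F p dF -> partial a i F p = dF.
Proof. by move=> [_]. Qed.

Lemma near_chart (P : X -> Prop) p : dom a p -> (forall q, dom a q -> P q) ->
  \forall x \near cmap a p, P (cinv a x).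
Proof.
move=> ap domP; have ap' : (cmap a @` dom a) (cmap a p) by exists p.
apply: filterS (open_nbhs_nbhs (conj (@image_open _ _ _ a) ap')) => _ [q aq <-].
by rewrite cmapK //; exact: domP.
Qed.

(** Since the chart image is open, an identity that holds throughout the chart domain can be
    differentiated. *)
Lemma has_partial_congr W i (F G : X -> W) p dF : dom a p ->
  (forall q, dom a q -> F q = G q) -> has_partial i F p dF -> has_partial i G p dF.
Proof.
move=> ap FG [dF_ <-]; have nFG := near_chart ap FG; split.
  exact: near_eq_derivable nFG dF_.
by apply: esym; exact: near_eq_derive nFG.
Qed.

Lemma smooth_has_partial W i (F : X -> W) p : smooth_in_chart F -> dom a p ->
  has_partial i F p (partial a i F p).
Proof.
move=> sF ap; apply: derivableP; apply: diff_derivable.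
by have [+ _] := sF 1; apply; exists p.
Qed.

Lemma smooth_partial W i (F : X -> W) :
  smooth_in_chart F -> smooth_in_chart (partial a i F).
Proof.
move=> sF k; have [_ /(_ 'e_i)] := sF k.+1.
apply: Ck_congr => [|_ [p ap <-]]; first exact: image_open.
by rewrite /partial /= cmapK.
Qed.

Lemma partial_comm m k i j (F : X -> 'M[R]_(m, k)) p : smooth_in_chart F ->
  dom a p -> partial a i (partial a j F) p = partial a j (partial a i F) p.
Proof.
move=> sF ap; have ap' : (cmap a @` dom a) (cmap a p) by exists p.
(* [partial] evaluates at [cmap a q], so its composite with [cinv a] is a directional derivative
   only on the chart image, where [cmap a] inverts [cinv a]. *)
have E l : {near cmap a p, partial a l F \o cinv a =1 'D_('e_l) (F \o cinv a)}.
  apply: filterS (open_nbhs_nbhs (conj (@image_open _ _ _ a) ap')) => _ [q aq <-].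
  by rewrite /partial /= cmapK.
have P k1 k2 : partial a k1 (partial a k2 F) p =
  'D_('e_k1) ('D_('e_k2) (F \o cinv a)) (cmap a p) := near_eq_derive _ (E k2).
by rewrite !P; exact: derive_comm_mx (@image_open _ _ _ a) sF ap'.
Qed.

End ChartDerivative.

#[local] Opaque partial.

(** * Skew symmetry and second Bianchi identity for a bundle connection *)

Section BundleCurvature.
Context {R : realType} {n : nat} {M : manifold R n} {r : nat} {E : vbundle M r}.
Variables (A : connection E) (a : frame E).
Implicit Types (i j m k : 'I_n) (p : M).

Notation c := (mchart_val (base a)).
Notation "'d_ i" := (partial c i) (at level 10, i at level 8, format "''d_' i").

Lemma has_partial_curvature m i j p : dom c p ->
  has_partial c m (curvature A a i j) p
    ('d_m ('d_i (A a j)) p - 'd_m ('d_j (A a i)) p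
     + ('d_m (A a i) p *m A a j p + A a i p *m 'd_m (A a j) p)
     - ('d_m (A a j) p *m A a i p + A a j p *m 'd_m (A a i) p)).
Proof.
move=> cp; have sA k : smooth_in_chart c (A a k) by exact: conn_smooth.
have d1 k : has_partial c m (A a k) p ('d_m (A a k) p).
  exact: smooth_has_partial.
have d2 k l : has_partial c m ('d_k (A a l)) p ('d_m ('d_k (A a l)) p).
  by apply: smooth_has_partial => //; exact: smooth_partial.
have q k l : has_partial c m (fun q => A a k q *m A a l q) p
    ('d_m (A a k) p *m A a l p + A a k p *m 'd_m (A a l) p).
  by have := is_derive_mulmx (d1 k) (d1 l); rewrite /= cmapK.
exact: is_deriveB (is_deriveD (is_deriveB (d2 i j) (d2 j i)) (q i j)) (q j i).
Qed.

Lemma curvature_skew i j p : curvature A a j i p = - curvature A a i j p.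
Proof. by rewrite /curvature; linear_mx. Qed.

Variable D : connection (tangent M).
Notation N := (nabla_endform D A (curvature A) a).

Lemma nabla_curvature_skew m i j p : dom c p -> N m j i p = - N m i j p.
Proof.
move=> cp; rewrite /nabla_endform !(partialE (has_partial_curvature _ _ _ cp)).
under eq_bigr do rewrite curvature_skew scalerN.
under [X in _ - X = _]eq_bigr do rewrite curvature_skew scalerN.
rewrite !sumrN (curvature_skew i j) mulmxN mulNmx.
linear_mx.
Qed.

Hypothesis D_torsion_free : forall p (k i j : 'I_n), dom c p ->
  christoffel D (base a) p k i j = christoffel D (base a) p k j i.

(** Second derivatives of the connection matrices cancel by commutation, the Leibniz terms cancel
    against the commutators with [A], and the Christoffel terms cancel in pairs. *)
Lemma differential_bianchi m i j p : dom c p ->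
  N m i j p + N i j m p + N j m i p = 0.
Proof.
move=> cp; rewrite /nabla_endform !(partialE (has_partial_curvature _ _ _ cp)).
have sA k : smooth_in_chart c (A a k) by exact: conn_smooth.
rewrite (partial_comm m i (sA j) cp) (partial_comm i j (sA m) cp).
rewrite (partial_comm j m (sA i) cp).
(* Absence of torsion and skewness of the curvature turn each Christoffel sum of one cyclic term
   into the negative of a sum of another. *)
have flip i1 i2 i3 : \sum_(k < n) christoffel D (base a) p k i1 i2 *: curvature A a i3 k p
    = - \sum_(k < n) christoffel D (base a) p k i2 i1 *: curvature A a k i3 p.
  rewrite -sumrN; apply: eq_bigr => k _.
  by rewrite D_torsion_free // curvature_skew scalerN.
rewrite (flip m j i) (flip i m j) (flip j i m) /curvature.
rewrite !(mulmxDl, mulmxDr, mulmxN, mulNmx, mulmxA).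
linear_mx.
Qed.

End BundleCurvature.

(** * Metric connections: the curvature and its covariant derivative are skew *)

Section MetricCurvature.
Context {R : realType} {n : nat} {M : manifold R n} {r : nat} {E : vbundle M r}.
Context {h : fiberMetric E}.
Variables (A : metricConnection h) (a : frame E).
Implicit Types (i j m k : 'I_n) (p : M).

Notation c := (mchart_val (base a)).

Lemma fmetric_has_partial i p : dom c p ->
  has_partial c i (h a) p ((A a i p)^T *m h a p + h a p *m A a i p).
Proof.
move=> cp; rewrite -(@mconn_compatible _ _ _ _ _ _ A) //.
by apply: smooth_has_partial => //; exact: fmetric_smooth.
Qed.

(** Integrability condition of metric compatibility: equating the two mixed second derivatives of
    [h] leaves exactly the skewness of [h] times the curvature. *)
Lemma metric_curvature_skew i j p : dom c p ->
  (h a p *m curvature A a i j p)^T = - (h a p *m curvature A a i j p).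
Proof.
move=> cp; have sA k : smooth_in_chart c (A a k) by exact: conn_smooth.
have dA k l : has_partial c k (A a l) p (partial c k (A a l) p).
  exact: smooth_has_partial.
(* Metric compatibility, differentiated once more and with the derivatives of [h] eliminated
   again. *)
have ddh k l : partial c k (partial c l (h a)) p =
    (partial c k (A a l) p)^T *m h a p
      + (A a l p)^T *m ((A a k p)^T *m h a p + h a p *m A a k p)
    + (((A a k p)^T *m h a p + h a p *m A a k p) *m A a l p
      + h a p *m partial c k (A a l) p).
  apply: partialE; apply: (@has_partial_congr _ _ _ _ _ _
      (fun q => (A a l q)^T *m h a q + h a q *m A a l q)) => //.
    by move=> q cq; rewrite (partialE (fmetric_has_partial l cq)).
  have dh := fmetric_has_partial k cp.
  have := is_deriveD (is_derive_mulmx (is_derive_trmx (dA k l)) dh)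
    (is_derive_mulmx dh (dA k l)).
  by rewrite /= cmapK.
have sh : smooth_in_chart c (h a) by exact: fmetric_smooth.
have := partial_comm i j sh cp; rewrite !ddh.
rewrite /curvature; move: (partial c i (A a j) p) (partial c j (A a i) p) => dij dji.
move: (A a i p) (A a j p) (fmetric_sym h cp); move: (h a p) => H Ai Aj symH.
rewrite trmx_mul symH !(trmxD, trmxN) !trmx_mul.
rewrite !(mulmxDl, mulmxDr, mulmxN, mulNmx, mulmxA).
linear_mx.
Qed.

(** The derivative of a skew function is skew, and metric compatibility lets [h] pass inside the
    covariant derivative, whose correction terms preserve skewness. *)
Lemma nabla_curvature_metric (D : connection (tangent M)) m i j p : dom c p ->
  (h a p *m nabla_endform D A (curvature A) a m i j p)^T =
  - (h a p *m nabla_endform D A (curvature A) a m i j p).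
Proof.
move=> cp; set F := curvature A a.
have dF k l : has_partial c m (F k l) p (partial c m (F k l) p).
  by have := has_partial_curvature A m k l cp => /[dup] /partialE ->.
have dh := fmetric_has_partial m cp.
have skF q : dom c q -> (F i j q)^T *m h a q = - (h a q *m F i j q).
  by move=> cq; rewrite -metric_curvature_skew // trmx_mul fmetric_sym.
have skdF : (partial c m (F i j) p)^T *m h a p
    + (F i j p)^T *m ((A a m p)^T *m h a p + h a p *m A a m p)
  = - (((A a m p)^T *m h a p + h a p *m A a m p) *m F i j p
    + h a p *m partial c m (F i j) p).
  have d1 := is_derive_mulmx (is_derive_trmx (dF i j)) dh.
  have d2 := is_deriveN (is_derive_mulmx dh (dF i j)).
  rewrite /= cmapK // in d1 d2.
  have d1' : has_partial c m (fun q => - (h a q *m F i j q)) p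
      ((partial c m (F i j) p)^T *m h a p
    + (F i j p)^T *m ((A a m p)^T *m h a p + h a p *m A a m p)).
    exact: has_partial_congr cp skF d1.
  exact: etrans (esym (partialE d1')) (partialE d2).
set dW := (X in _ = - X) in skdF; pose W k l := h a p *m F k l p.
have W_skew k l : (W k l)^T = - W k l by exact: metric_curvature_skew.
have dW_skew : dW^T = - dW.
  rewrite -skdF /dW !(trmxD, trmx_mul) trmxK.
  by rewrite !(@fmetric_sym _ _ _ _ _ h) // [LHS]addrC [h a p *m _ + _]addrC.
(* [dW] is the derivative of [W i j]. It contains one more term than [h] times the derivative of the
   curvature, which changes the commutator into a sum that is skew along with [W i j]. *)
have -> : h a p *m nabla_endform D A (curvature A) a m i j p =
    dW - ((A a m p)^T *m W i j + W i j *m A a m p)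
    - \sum_(k < n) christoffel D (base a) p k m i *: W k j
    - \sum_(k < n) christoffel D (base a) p k m j *: W i k.
  rewrite /nabla_endform !(mulmxDr, mulmxN, mulmx_sumr).
  under eq_bigr do rewrite -scalemxAr.
  under [X in _ - X = _]eq_bigr do rewrite -scalemxAr.
  rewrite /dW /W !(mulmxDl, mulmxDr, mulmxN, mulmxA).
  linear_mx.
have sum_skew (x : 'I_n -> R) (B : 'I_n -> 'M[R]_r) : (forall k, (B k)^T = - B k) ->
    (\sum_k x k *: B k)^T = - \sum_k x k *: B k.
  move=> sB; rewrite raddf_sum /= -sumrN; apply: eq_bigr => k _.
  have -> : (x k *: B k)^T = x k *: (B k)^T by apply/matrixP => s t; rewrite !mxE.
  by rewrite sB scalerN.
clearbody dW W.
rewrite !(trmxD, trmxN) dW_skew !sum_skew // !trmx_mul trmxK W_skew.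
rewrite mulmxN mulNmx; linear_mx.
Qed.

End MetricCurvature.

(** * Levi-Civita case: first Bianchi identity, traces of the curvature, energy-momentum tensor *)

Section LeviCivitaCurvature.
Context {R : realType} {n : nat} {M : manifold R n} {g : fiberMetric (tangent M)}.
Variables (D : leviCivita g) (a : mchart M).
Implicit Types (i j k l m : 'I_n) (p : M).

Notation Gamma := (conn D a).
Notation Riem := (curvature D a).
Notation N := (nabla_endform D D (curvature D) a).

Let Gamma_sym i k l p : dom a p -> Gamma i p k l = Gamma l p k i.
Proof. exact: torsion_free. Qed.

Let has_partial_entry m r s (F : M -> 'M[R]_(r, s)) dF p :
  has_partial a m F p dF -> forall x y, has_partial a m (fun q => F q x y) p (dF x y).
Proof. by move/is_derive_mxP. Qed.

Let has_partial_Gamma m i p : dom a p ->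
  has_partial a m (Gamma i) p (partial a m (Gamma i) p).
Proof.
by move=> ap; apply: smooth_has_partial => //; exact: (@conn_smooth _ _ _ _ _ D a i).
Qed.

Let has_partial_Riem m i j p : dom a p ->
  has_partial a m (Riem i j) p (partial a m (Riem i j) p).
Proof.
move=> ap; have := @has_partial_curvature _ _ _ _ (tangent M) D a m i j p ap.
by move=> /[dup] /partialE ->.
Qed.

(** The derivative terms and the quadratic terms inherit the symmetry of the Christoffel symbols in
    their lower indices, so each kind cancels separately in the cyclic sum. *)
Lemma algebraic_bianchi i j k l p : dom a p ->
  Riem i j p k l + Riem j l p k i + Riem l i p k j = 0.
Proof.
move=> ap.
have dsym i1 i2 i3 : partial a i1 (Gamma i2) p k i3 = partial a i1 (Gamma i3) p k i2.
  have d2 := has_partial_entry (has_partial_Gamma i1 i2 ap) k i3.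
  have d3 := has_partial_entry (has_partial_Gamma i1 i3 ap) k i2.
  rewrite -(partialE d2); apply: partialE; apply: has_partial_congr ap _ d3.
  by move=> q aq; rewrite Gamma_sym.
have psym i1 i2 i3 :
    (Gamma i1 p *m Gamma i2 p) k i3 = (Gamma i1 p *m Gamma i3 p) k i2.
  by rewrite !mxE; apply: eq_bigr => b _; rewrite (Gamma_sym i2).
have cyclic (P Q : 'I_n -> 'I_n -> 'M[R]_n) :
    (forall i1 i2 i3, P i1 i2 k i3 = P i1 i3 k i2) ->
    (forall i1 i2 i3, Q i1 i2 k i3 = Q i1 i3 k i2) ->
    (P i j - P j i + Q i j - Q j i) k l + (P j l - P l j + Q j l - Q l j) k i
      + (P l i - P i l + Q l i - Q i l) k j = 0.
  move=> sP sQ; rewrite !(addmxE, oppmxE).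
  rewrite (sP i j l) (sP j i l) (sP l j i) (sQ i j l) (sQ j i l) (sQ l j i); ring.
exact: (cyclic (fun x y => partial a x (Gamma y) p) (fun x y => Gamma x p *m Gamma y p)).
Qed.

(** The corrections for the three lower indices share one sum, so that cyclic sums can be compared
    term by term. *)
Lemma nabla_curvatureE m i j k l p : N m i j p k l =
  partial a m (Riem i j) p k l
  + \sum_b Gamma m p k b * Riem i j p b l
  - \sum_b (Riem i j p k b * Gamma m p b l
            + Gamma m p b i * Riem b j p k l + Gamma m p b j * Riem i b p k l).
Proof.
rewrite /nabla_endform !(addmxE, oppmxE) !summxE [(_ *m _) k l]mxE.
rewrite [(Riem _ _ _ *m _) k l]mxE !big_split /= !opprD !addrA.
by congr (_ - _ - _); apply: eq_bigr => b _; rewrite mxE.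
Qed.

(** The derivative part is [algebraic_bianchi] differentiated along the chart; the Christoffel
    corrections vanish by the same identity at the point. *)
Lemma nabla_algebraic_bianchi m k l i j p : dom a p ->
  N m i j p k l + N m j l p k i + N m l i p k j = 0.
Proof.
move=> ap; rewrite (nabla_curvatureE m i j) (nabla_curvatureE m j l).
rewrite (nabla_curvatureE m l i).
have d i1 i2 := has_partial_entry (has_partial_Riem m i1 i2 ap) k.
have dcyc : partial a m (Riem i j) p k l + partial a m (Riem j l) p k i
    + partial a m (Riem l i) p k j = 0.
  have := is_deriveD (is_deriveD (d i j l) (d j l i)) (d l i j).
  move=> /(@derive_val _ _ _ _ _ _ _) <-.
  apply: (@partialE _ _ _ a _ m
    (fun q => Riem i j q k l + Riem j l q k i + Riem l i q k j)).
  apply: (has_partial_congr ap _ (is_derive_cst (0 : R) _ _)).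
  by move=> q aq; rewrite algebraic_bianchi.
have cyclic (C : 'M[R]_n) (r : 'I_n -> 'I_n -> 'M[R]_n) x y z :
    (forall i j k l, r i j k l + r j l k i + r l i k j = 0) -> x + y + z = 0 ->
    x + \sum_b C k b * r i j b l
      - \sum_b (r i j k b * C b l + C b i * r b j k l + C b j * r i b k l)
    + (y + \sum_b C k b * r j l b i
      - \sum_b (r j l k b * C b i + C b j * r b l k i + C b l * r j b k i))
    + (z + \sum_b C k b * r l i b j
      - \sum_b (r l i k b * C b j + C b l * r b i k j + C b i * r l b k j)) = 0.
  move=> sr xyz.
  have regroup (s1 s2 s3 t1 t2 t3 : R) : x + s1 - t1 + (y + s2 - t2)
      + (z + s3 - t3) = x + y + z + (s1 + s2 + s3) - (t1 + t2 + t3) by ring.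
  rewrite regroup xyz -!big_split /= big1 => [|b _]; last first.
    by rewrite -!mulrDr sr mulr0.
  rewrite big1 ?addr0 ?subrr // => b _.
  (* Grouped by Christoffel factor, the nine lower-index corrections have cyclic sums as
     coefficients. *)
  have regroup' (t1 t2 t3 t4 t5 t6 t7 t8 t9 : R) :
      t1 * C b l + C b i * t2 + C b j * t3 + (t4 * C b i + C b j * t5 + C b l * t6)
      + (t7 * C b j + C b l * t8 + C b i * t9)
    = C b l * (t1 + t6 + t8) + C b i * (t2 + t4 + t9) + C b j * (t3 + t5 + t7).
    by ring.
  by rewrite regroup' !sr !mulr0 !addr0.
exact: cyclic (fun _ _ _ _ => algebraic_bianchi _ _ _ _ ap) dcyc.
Qed.

Lemma has_partial_ricci k p : dom a p -> has_partial a k (ricci D a) p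
  (\matrix_(i, j) \sum_l partial a k (Riem l j) p l i).
Proof.
move=> ap; apply/is_derive_mxP => x y; under eq_fun do rewrite mxE; rewrite mxE.
by apply: is_derive_bigsum => l; exact: has_partial_entry (has_partial_Riem k l y ap) l x.
Qed.

(** Covariant differentiation commutes with contraction: the corrections for the two contracted
    indices cancel. *)
Lemma nabla_ricciE k i j p : dom a p ->
  nabla_tensor2 D (ricci D) a p k i j = \sum_l N k l j p l i.
Proof.
move=> ap; rewrite /nabla_tensor2 (partialE (has_partial_ricci k ap)) mxE.
under [RHS]eq_bigr do rewrite nabla_curvatureE.
rewrite sumrB !big_split /= -!addrA; congr (_ + _).
under eq_bigr do rewrite mxE mulr_sumr; rewrite exchange_big /=.
under [X in _ - X]eq_bigr do rewrite mxE mulr_sumr; rewrite [X in _ - X]exchange_big /=.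
under [X in _ = _ - X]eq_bigr do rewrite !big_split /=.
rewrite !big_split /= [X in _ = X - _]exchange_big /=.
rewrite [X in _ = _ - (X + _)]addrC -[X in _ = _ - X]addrA opprD addrA subrr add0r opprD.
by congr (- _ + - _); apply: eq_bigr => l _; apply: eq_bigr => b _; rewrite mulrC.
Qed.

Let has_partial_g m p : dom a p ->
  has_partial a m (g a) p ((Gamma m p)^T *m g a p + g a p *m Gamma m p).
Proof. exact: (@fmetric_has_partial _ _ _ _ (tangent M)). Qed.

Let g_sym p : dom a p -> (g a p)^T = g a p.
Proof. exact: (@fmetric_sym _ _ _ _ (tangent M)). Qed.

Let g_unit p : dom a p -> g a p \in unitmx.
Proof. exact: (@fmetric_nondeg _ _ _ _ (tangent M)). Qed.

Lemma nabla_tensor2E k (T : mchart M -> M -> 'M[R]_n) dT p : has_partial a k (T a) p dT ->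
  \matrix_(i, j) nabla_tensor2 D T a p k i j =
    dT - (Gamma k p)^T *m T a p - T a p *m Gamma k p.
Proof.
move=> hT; apply/matrixP => i j; rewrite !(addmxE, oppmxE) /nabla_tensor2 (partialE hT).
rewrite ![in RHS]mxE mxE; congr (_ - _ - _); apply: eq_bigr => l _; rewrite ?mxE //.
by rewrite mulrC.
Qed.

(** The inverse metric is parallel, so differentiating the trace amounts to tracing the covariant
    derivative of the Ricci tensor. *)
Lemma scalar_curvature_has_partial k p : dom a p ->
  has_partial a k (scalar_curvature g D a) p
    (\sum_i \sum_j invmx (g a p) i j * nabla_tensor2 D (ricci D) a p k i j).
Proof.
move=> ap; have symg := g_sym ap; have ug := g_unit ap.
have := has_partial_ricci k ap; set dRic := (X in has_partial _ _ _ _ X) => hRic.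
have := is_derive_invmx (near_chart ap g_unit) (has_partial_g k ap).
rewrite /= cmapK //; set dI := (X in is_derive _ _ _ X) => hI.
have hs : has_partial a k (scalar_curvature g D a) p
    (\sum_i \sum_j (dI i j * ricci D a p i j + invmx (g a p) i j * dRic i j)).
  apply: is_derive_bigsum => i; apply: is_derive_bigsum => j.
  have := is_derive_mul ((is_derive_mxP _ _ _ _).1 hI i j)
    ((is_derive_mxP _ _ _ _).1 hRic i j).
  by rewrite /= cmapK.
apply: is_derive_eq hs _.
(* Metric compatibility inside the derivative of the inverse; these two terms supply the Christoffel
   corrections of the Ricci tensor. *)
have dIE : dI^T = - (Gamma k p *m invmx (g a p) + invmx (g a p) *m (Gamma k p)^T).
  rewrite /dI trmxN mulmxDr (mulmxA _ (g a p)) mulVmx // mul1mx mulmxDl -!mulmxA.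
  by rewrite mulmxV // mulmx1 trmxD !trmx_mul trmxK trmx_inv symg.
have -> : \sum_i \sum_j invmx (g a p) i j * nabla_tensor2 D (ricci D) a p k i j =
    \tr (invmx (g a p) *m
      (dRic - (Gamma k p)^T *m ricci D a p - ricci D a p *m Gamma k p)).
  rewrite -{2}symg -trmx_inv mxtrace_mul_tr -(nabla_tensor2E hRic).
  by apply: eq_bigr => i _; apply: eq_bigr => j _; rewrite [in RHS]mxE.
under eq_bigr do rewrite big_split; rewrite big_split /=.
rewrite -!mxtrace_mul_tr dIE trmx_inv symg.
clearbody dRic; move: (ricci D a p) (Gamma k p) (invmx (g a p)) => Ric G H.
have mxtraceN (A : 'M[R]_n) : \tr (- A) = - \tr A by exact: raddfN.
rewrite !(mulmxDr, mulmxN, mulNmx, mulmxDl) !(mxtraceD, mxtraceN).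
have -> : \tr (G *m H *m Ric) = \tr (H *m (Ric *m G)).
  by rewrite -mulmxA mxtrace_mulC mulmxA.
rewrite !mulmxA; ring.
Qed.

(** Since the metric is parallel, the term s g / 2 contributes only ds, which is the trace in
    parentheses. *)
Lemma nabla_energy_momentumE k i j p : dom a p ->
  nabla_tensor2 D (energy_momentum g D) a p k i j =
  nabla_tensor2 D (ricci D) a p k i j
  - 2^-1 * (\sum_i \sum_j invmx (g a p) i j * nabla_tensor2 D (ricci D) a p k i j)
    * g a p i j.
Proof.
move=> ap; set sigma := \sum_i _; set s := scalar_curvature g D a.
have hs : has_partial a k s p sigma by exact: scalar_curvature_has_partial.
have hg := has_partial_g k ap; have hRic := has_partial_ricci k ap.
have hT := is_deriveB hRic (is_derive_scalemx (is_deriveZ 2^-1 hs) hg).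
rewrite /= cmapK // in hT.
have /matrixP/(_ i j) := @nabla_tensor2E k (energy_momentum g D) _ p hT.
have /matrixP/(_ i j) := nabla_tensor2E hRic.
rewrite [LHS]mxE => ->; rewrite [LHS]mxE => ->.
rewrite /energy_momentum -/s.
move: (g a p) (ricci D a p) (s p) (Gamma k p) => G Ric t C.
move: (\matrix_(_, _) _) => dRic.
rewrite !(mulmxDr, mulmxDl, mulmxN, mulNmx) -scalemxAr -scalemxAl.
have scalemxE (x : R) (A : 'M[R]_n) : (x *: A) i j = x * A i j by rewrite mxE.
rewrite !(addmxE, oppmxE, scalemxE) -![2^-1 *: _]/(2^-1 * _); ring.
Qed.

(** Feeds the components of the covariant derivative of the curvature at [p] into
    [codazzi_div_free]. *)
Lemma nabla_energy_momentum_symP p : n != 2 -> dom a p ->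
  (forall i j k, nabla_tensor2 D (energy_momentum g D) a p k i j =
                 nabla_tensor2 D (energy_momentum g D) a p i k j) <->
  (forall j, codifferential g D D (curvature D) a j p = 0).
Proof.
move=> n2 ap.
have N_skew m i j : N m j i p = - N m i j p by exact: nabla_curvature_skew.
have N_metric m i j : (g a p *m N m i j p)^T = - (g a p *m N m i j p).
  exact: (@nabla_curvature_metric _ _ _ _ (tangent M)).
have N_bianchi1 m k l i j : N m i j p k l + N m j l p k i + N m l i p k j = 0.
  exact: nabla_algebraic_bianchi.
have N_bianchi2 m i j : N m i j p + N i j m p + N j m i p = 0.
  by apply: differential_bianchi => // q k x y; exact: torsion_free.
have E := @codazzi_div_free _ _ (g a p) (fun m i j => N m i j p) (g_sym ap)
  (g_unit ap) N_skew N_metric N_bianchi1 N_bianchi2 n2.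
have ric k i j := nabla_ricciE k i j ap.
have tau k i j : nabla_tensor2 D (energy_momentum g D) a p k i j =
    (\sum_l N k l j p l i) - 2^-1 * (\sum_x \sum_y invmx (g a p) x y *
      (\sum_l N k l y p l x)) * g a p i j.
  rewrite nabla_energy_momentumE // ric; congr (_ - _ * _ * _).
  by apply: eq_bigr => x _; apply: eq_bigr => y _; rewrite ric.
split=> [T_sym j|div0].
  rewrite /codifferential -[RHS]oppr0; congr (- _); apply: E.1 => x y z.
  by rewrite -!tau.
move=> i j k; rewrite !tau; apply: E.2 => l.
by apply: oppr_inj; rewrite oppr0; exact: div0.
Qed.

End LeviCivitaCurvature.

Theorem theorem3 (R : realType) (M : manifold R 4)
    (g : fiberMetric (tangent M)) (g_lorentzian : lorentzian g)
    (nabla : leviCivita g) :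
  class_Omega2 nabla <-> yang_mills nabla (levi_civita nabla).
Proof.
(* Here [isT] proves [4 != 2]. The equivalence holds at each point of each chart for all indices
   together. *)
have P (a : mchart M) p (ap : dom a p) :=
  @nabla_energy_momentum_symP _ _ _ _ nabla a p isT ap.
split=> [H a j p ap|H T a p i j k ap].
  exact: (P a p ap).1 (fun i j k => H a p i j k ap) j.
exact: (P a p ap).2 (fun j => H a j p ap) i j k.
Qed.
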